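(* Let $X$ be a graph on $m\ge3$ vertices. Suppose that for some positive divisor $g$ of $m$, proper Laplacian fractional revival occurs on $X$ between vertices $a$ and $b$ at time $2\pi/g$. Let $Y$ be any graph on $n$ vertices such that $g$ divides $n$. Then the join $X+Y$ admits proper Laplacian fractional revival between $a$ and $b$ at time $2\pi/g$.
   Context: For a graph $X$ with adjacency matrix $A$ and diagonal degree matrix $D$, the Laplacian is $L=D-A$ and the transition matrix is $U(t)=\exp(itL)$. $X$ admits Laplacian fractional revival from vertex $a$ to vertex $b\neq a$ at time $\tau$ if $U(\tau)e_a=\alpha e_a+\beta e_b$ for some complex $\alpha,\beta$; it is proper if $\beta\neq0$. The join $X+Y$ is obtained from the disjoint union of $X$ and $Y$ by joining every vertex of $X$ to every vertex of $Y$. *)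

(* Defs.v *)
From HB Require Import structures.
From mathcomp Require Import all_boot all_order all_algebra.
From mathcomp Require Import complex.
From mathcomp Require Import all_classical all_reals all_analysis.

Set Implicit Arguments.
Unset Strict Implicit.
Unset Printing Implicit Defensive.

Import Order.TTheory GRing.Theory Num.Theory.
Import numFieldTopology.Exports numFieldNormedType.Exports.

Local Open Scope classical_set_scope.
Local Open Scope ring_scope.
Local Open Scope complex_scope.

Record sgraph (n : nat) := SGraph {
  adj :> rel 'I_n;
  adj_sym : symmetric adj;
  adj_irr : irreflexive adj
}.

(* [fintype.split] sends the vertices [lshift n x] of 'I_(m + n) to [inl x] and the
   vertices [rshift m y] to [inr y]. *)
Definition join_adj (m n : nat) (X : sgraph m) (Y : sgraph n) :
    rel 'I_(m + n) :=
  fun u v => match fintype.split u, fintype.split v with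
    | inl x, inl x' => X x x'
    | inr y, inr y' => Y y y'
    | _, _ => true
    end.

Lemma join_adj_sym (m n : nat) (X : sgraph m) (Y : sgraph n) :
  symmetric (join_adj X Y).
Proof.
move=> u v; rewrite /join_adj.
by case: (fintype.split u) => x; case: (fintype.split v) => y //; apply: adj_sym.
Qed.

Lemma join_adj_irr (m n : nat) (X : sgraph m) (Y : sgraph n) :
  irreflexive (join_adj X Y).
Proof. by move=> u; rewrite /join_adj; case: (fintype.split u) => x; apply: adj_irr. Qed.

Definition graph_join (m n : nat) (X : sgraph m) (Y : sgraph n) : sgraph (m + n) :=
  SGraph (join_adj_sym X Y) (join_adj_irr X Y).

Section Laplacian.
Variables (C : nzRingType) (n : nat) (X : sgraph n).

Definition degree (u : 'I_n) : nat := #|[set v | X u v]%SET|.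

Definition adjmx : 'M[C]_n := \matrix_(u, v) (X u v)%:R.

Definition degmx : 'M[C]_n := diag_mx (\row_u (degree u)%:R).

Definition laplacian : 'M[C]_n := degmx - adjmx.

End Laplacian.

(* The limit is taken in the normed space of complex matrices, where the series
   always converges, so the default value of [lim] is never reached. *)
Definition expmx (R : realType) (n : nat) (M : 'M[R[i]]_n) : 'M[R[i]]_n :=
  lim (series (fun k => (k`!%:R)^-1 *: M ^+ k) @ \oo).

Definition transition (R : realType) (n : nat) (X : sgraph n) (t : R) :
    'M[R[i]]_n :=
  expmx (('i%C * t%:C) *: laplacian R[i] X).

Definition vertex_vec (R : realType) (n : nat) (a : 'I_n) : 'cV[R[i]]_n :=
  delta_mx a 0.

Definition proper_laplacian_FR (R : realType) (n : nat) (X : sgraph n)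
    (a b : 'I_n) (tau : R) : Prop :=
  a != b /\
  exists alpha beta : R[i],
    transition X tau *m vertex_vec R a
      = alpha *: vertex_vec R a + beta *: vertex_vec R b
    /\ beta != 0.

(* Main.v *)
(* Let J be the m x m matrix with all entries 1/m and W the (m + n) x m matrix with
   blocks I - J and 0. Since I - J kills constants, L_{X+Y} W = W (L_X + n I), hence
   U_{X+Y}(t) W = e^{itn} W U_X(t). The indicator of V(X) lies in the sum of the
   eigenspaces of L_{X+Y} for the eigenvalues 0 and m + n. If e^{itm} = e^{itn} = 1,
   which divisibility by g gives at t = 2 pi / g, then U_{X+Y}(t) (v, 0) = (U_X(t) v, 0)
   for every v, and fractional revival on X is revival on X + Y with the same
   coefficients.
   The identity exp(i t (L + c I)) = e^{itc} exp(i t L) and the convergence of the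
   exponential series are read off a spectral decomposition of the Hermitian matrix L,
   which reduces both to the series of cos and sin. *)
Require Import Defs.
From HB Require Import structures.
From mathcomp Require Import all_boot all_order all_algebra.
From mathcomp Require Import complex ring.
From mathcomp Require Import all_classical all_reals all_analysis.

Set Implicit Arguments.
Unset Strict Implicit.
Unset Printing Implicit Defensive.

Import Order.TTheory GRing.Theory Num.Theory.
Import numFieldTopology.Exports numFieldNormedType.Exports.

Local Open Scope classical_set_scope.
Local Open Scope ring_scope.
Local Open Scope complex_scope.

(** * The matrix exponential series *)

(** A neighbourhood of a matrix contains a product of neighbourhoods of its entries, and finitely
    many eventual conditions hold together. *)
Lemma cvg_mx (K : numFieldType) m n (u : nat -> 'M[K]_(m, n)) (l : 'M[K]_(m, n)) :
  (forall i j, u k i j @[k --> \oo] --> l i j) -> u @ \oo --> l.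
Proof.
move=> ul A [P Pl PA].
have : \forall k \near \oo, forall i j, P i j (u k i j).
  by apply: filter_forall => i; apply: filter_forall => j; exact: (ul i j _ (Pl i j)).
by apply: filterS => k Pk; exact: PA.
Qed.

Lemma cvg_sum (K : numFieldType) (I : finType) (f : I -> nat -> K) (l : I -> K) :
  (forall i, f i @ \oo --> l i) -> (\sum_i f i k) @[k --> \oo] --> \sum_i l i.
Proof.
move=> fl.
by apply: (@cvg_big K I +%R 0 xpredT (@add_continuous K)) => i _; exact: fl.
Qed.

Lemma cvg_mulmx (K : numFieldType) m n p q (U : 'M[K]_(m, n)) (V : 'M[K]_(p, q))
    (u : nat -> 'M[K]_(n, p)) (l : 'M[K]_(n, p)) :
  u @ \oo --> l -> (U *m u k *m V) @[k --> \oo] --> U *m l *m V.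
Proof.
move=> ul; apply: cvg_mx => i j.
have -> : (fun k => (U *m u k *m V) i j) =
    (fun k => \sum_s (\sum_r U i r * u k r s) * V s j).
  by apply/funext => k; rewrite mxE; apply: eq_bigr => s _; rewrite mxE.
rewrite mxE; apply: cvg_sum => s; apply: cvgMr_tmp.
rewrite mxE; apply: cvg_sum => r; apply: cvgMl_tmp.
exact: (cvg_comp _ _ ul (@coord_continuous _ _ _ r s l)).
Qed.

(** The sequence whose limit is [expmx], named so that convergence can be stated apart from
    [lim]. *)
Definition exp_series (K : numFieldType) n (A : 'M[K]_n) : nat -> 'M[K]_n :=
  series (fun k => k`!%:R^-1 *: A ^+ k).

(** [W] may be rectangular: this serves both a change of basis and the passage between graphs of
    different sizes. *)
Lemma intertwine_exp (K : pzRingType) m n (A : 'M[K]_m) (B : 'M[K]_n)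
    (W : 'M[K]_(m, n)) k :
  A *m W = W *m B -> A ^+ k *m W = W *m B ^+ k.
Proof.
move=> AW; elim: k => [|k IH]; first by rewrite mul1mx mulmx1.
by rewrite !exprSr -!mulmxE -mulmxA AW mulmxA IH mulmxA.
Qed.

Lemma intertwine_exp_series (K : numFieldType) m n (A : 'M[K]_m) (B : 'M[K]_n)
    (W : 'M[K]_(m, n)) k :
  A *m W = W *m B -> exp_series A k *m W = W *m exp_series B k.
Proof.
move=> AW; rewrite /exp_series /series /= mulmx_suml mulmx_sumr.
by apply: eq_bigr => i _; rewrite -scalemxAl -scalemxAr (intertwine_exp _ AW).
Qed.

Lemma intertwine_exp_lim (K : numFieldType) m n (A : 'M[K]_m) (B : 'M[K]_n)
    (W : 'M[K]_(m, n)) (EA : 'M[K]_m) (EB : 'M[K]_n) :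
  A *m W = W *m B -> exp_series A @ \oo --> EA -> exp_series B @ \oo --> EB ->
  EA *m W = W *m EB.
Proof.
move=> AW cA cB.
(* [cvg_mulmx] is two-sided, so each one-sided product is padded with an identity; uniqueness of
   limits then concludes. *)
have := @cvg_mulmx K _ _ _ _ 1%:M W _ _ cA; have := @cvg_mulmx K _ _ _ _ W 1%:M _ _ cB.
rewrite mul1mx mulmx1.
have -> : (fun k => 1%:M *m exp_series A k *m W) = (fun k => W *m exp_series B k *m 1%:M).
  by apply/funext => k; rewrite mul1mx mulmx1; exact: intertwine_exp_series.
by move=> cWB cAW; exact: (cvg_unique _ cAW cWB).
Qed.

(** * Exponentials of Hermitian matrices *)

(** This is [e^{it}], given by its real and imaginary parts so that the real series of cosine and
    sine apply. *)
Definition cis (R : realType) (t : R) : R[i] := cos t +i* sin t.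

(* R[i] carries a topology only through its numFieldType structure, hence the casts. *)
Lemma cvg_real_complex (R : realType) (u : nat -> R) (l : R) :
  u @ \oo --> l ->
  ((u k)%:C : (R[i] : numFieldType)) @[k --> \oo] --> (l%:C : (R[i] : numFieldType)).
Proof.
move=> /cvgrPdist_lt ul; apply/cvgrPdist_lt => e e0.
(* Positive elements of [R[i]] are real, so [e] is the image of a real radius. *)
have re : (complex.Re e)%:C = e by rewrite RRe_real// gtr0_real.
have re0 : 0 < complex.Re e by rewrite -ltcR re.
near=> k.
rewrite -[X in _ < X]re -rmorphB normc_def /= expr0n /= addr0 sqrtr_sqr ltcR.
by near: k; exact: ul.
Unshelve. all: by end_near. Qed.

Lemma cis_coeff (R : realType) (t : R) k :
  k`!%:R^-1 * ('i * t%:C) ^+ k = (cos_coeff t k)%:C + 'i * (sin_coeff t k)%:C.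
Proof.
(* Even powers of ['i] feed the cosine and odd ones the sine; at [k = 0] the truncated [k.-1] is
   masked by the factor [odd k]. *)
have ik : 'i ^+ k = ((~~ odd k)%:R * (-1) ^+ k./2)%:C
                    + 'i * ((odd k)%:R * (-1) ^+ k.-1./2)%:C :> R[i].
  rewrite -[in LHS](odd_double_half k) exprD -muln2 mulnC exprM sqr_i.
  have [ok|ok] := boolP (odd k).
    rewrite /= mul0r rmorph0 add0r mul1r expr1 rmorphXn rmorphN1; congr (_ * _ ^+ _).
    by rewrite -[in RHS](odd_double_half k) ok /= doubleK.
  by rewrite /= expr0 mul1r mul0r rmorph0 mulr0 addr0 mul1r rmorphXn rmorphN1.
rewrite exprMn ik cos_coeffE sin_coeffE /= -rmorphXn.
rewrite -[k`!%:R](rmorph_nat (real_complex R)) -fmorphV.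
rewrite !rmorphM /=; set a := _%:C; set b := _%:C.
ring.
Qed.

Lemma cvg_cis (R : realType) (t : R) :
  series (fun k => k`!%:R^-1 * ('i * t%:C) ^+ k : (R[i] : numFieldType)) @ \oo
    --> (cis t : (R[i] : numFieldType)).
Proof.
rewrite [cis t]complexE /=.
have -> : series (fun k => k`!%:R^-1 * ('i * t%:C) ^+ k : (R[i] : numFieldType))
  = (fun k => (series (cos_coeff t) k)%:C + 'i * (series (sin_coeff t) k)%:C).
  apply/funext => k; rewrite /series /= !rmorph_sum mulr_sumr -big_split /=.
  by apply: eq_bigr => i _; rewrite cis_coeff.
(* [cos] unfolds to the limit of this series, so only its convergence is at stake; likewise for
   [sin]. *)
have cc : series (cos_coeff t) @ \oo --> cos t.
  by rewrite cos.unlock; exact: is_cvg_series_cos_coeff.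
have cs : series (sin_coeff t) @ \oo --> sin t.
  by rewrite sin.unlock; exact: is_cvg_series_sin_coeff.
apply: (@cvgD (R[i] : numFieldType) (R[i] : numFieldType)); first exact: cvg_real_complex.
by apply: cvgMl_tmp; exact: cvg_real_complex.
Qed.

Lemma diag_mxX (K : comPzRingType) n (d : 'rV[K]_n) k :
  diag_mx d ^+ k = diag_mx (\row_j d 0 j ^+ k).
Proof.
elim: k => [|k IH].
  rewrite -[LHS]/(1%:M) -diag_const_mx; congr diag_mx.
  by apply/rowP => j; rewrite !mxE.
rewrite exprS IH -mulmxE mulmx_diag; congr diag_mx.
by apply/rowP => j; rewrite !mxE exprS.
Qed.

Lemma cvg_exp_series_diag (R : realType) n (t : R) (r : 'I_n -> R) :
  exp_series (K := R[i]) (('i * t%:C) *: diag_mx (\row_j (r j)%:C)) @ \oo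
    --> (diag_mx (\row_j cis (t * r j)) : 'M[R[i] : numFieldType]_n).
Proof.
apply: cvg_mx => i j.
(* The factor [i == j] handles diagonal and off-diagonal entries at once. *)
have -> : (fun k => exp_series (K := R[i]) (('i * t%:C) *: diag_mx (\row_j (r j)%:C)) k i j)
    = (fun k => (i == j)%:R *
        series (fun k => k`!%:R^-1 * ('i * (t * r i)%:C) ^+ k : (R[i] : numFieldType)) k).
  apply/funext => k; rewrite /exp_series /series /= summxE mulr_sumr.
  apply: eq_bigr => l _.
  have -> : 'i * (t * r i)%:C = 'i * t%:C * (r i)%:C by rewrite rmorphM mulrA.
  by rewrite -linearZ /= diag_mxX !mxE -[_ *+ (i == j)]mulr_natl mulrCA.
rewrite !mxE -[X in _ --> X]mulr_natl.
exact: (@cvgMl_tmp R[i] _ _ _ _ _ _ (@cvg_cis R (t * r i))).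
Qed.

(** [invmx P] intertwines the conjugate of [A] with [A], so each partial sum is conjugated too. *)
Lemma cvg_exp_series_conj (K : numFieldType) n (P A E : 'M[K]_n) :
  P \in unitmx -> exp_series A @ \oo --> E ->
  exp_series (invmx P *m A *m P) @ \oo --> invmx P *m E *m P.
Proof.
move=> Pu cA.
have -> : exp_series (invmx P *m A *m P) = (fun k => invmx P *m exp_series A k *m P).
  apply/funext => k.
  by rewrite -(@intertwine_exp_series _ _ _ (invmx P *m A *m P)) ?mulmxKV// mulmxK.
exact: (@cvg_mulmx K _ _ _ _ (invmx P) P _ _ cA).
Qed.

Lemma cvg_exp_series_diagonalizable (R : realType) n (t : R) (P : 'M[R[i]]_n)
    (r : 'I_n -> R) :
  P \in unitmx ->
  exp_series (K := R[i]) (('i * t%:C) *: (invmx P *m diag_mx (\row_j (r j)%:C) *m P)) @ \oo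
    --> (invmx P *m diag_mx (\row_j cis (t * r j)) *m P : 'M[R[i] : numFieldType]_n).
Proof.
move=> Pu; rewrite scalemxAl scalemxAr.
exact: (@cvg_exp_series_conj R[i] _ _ _ _ Pu (@cvg_exp_series_diag R n t r)).
Qed.

Lemma expmx_diagonalizable (R : realType) n (t : R) (P : 'M[R[i]]_n) (r : 'I_n -> R) :
  P \in unitmx ->
  expmx (('i * t%:C) *: (invmx P *m diag_mx (\row_j (r j)%:C) *m P)) =
  invmx P *m diag_mx (\row_j cis (t * r j)) *m P.
Proof.
move=> Pu; rewrite /expmx.
have hM : hausdorff_space 'M[R[i] : numFieldType]_n by exact: norm_hausdorff.
exact: (@cvg_lim _ hM _ _ _ _ _ (@cvg_exp_series_diagonalizable R n t P r Pu)).
Qed.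

(** The spectral theorem, with the eigenvalues stored as real numbers so that they can enter the
    angles of [cis]. *)
Lemma hermitian_diagonalization (R : realType) n (A : 'M[R[i]]_n) :
  A \is hermsymmx -> exists P : 'M[R[i]]_n, exists r : 'I_n -> R,
    P \in unitmx /\ A = invmx P *m diag_mx (\row_j (r j)%:C) *m P.
Proof.
move=> hA; exists (spectralmx A), (fun j => complex.Re (spectral_diag A 0 j)).
split; first exact: spectral_unit.
have -> : \row_j (complex.Re (spectral_diag A 0 j))%:C = spectral_diag A.
  apply/rowP => j; rewrite !mxE RRe_real//.
  by have /mxOverP := hermitian_spectral_diag_real hA; apply.
exact/orthomx_spectralP/hermitian_normalmx.
Qed.

Lemma cvg_expmx_hermitian (R : realType) n (t : R) (A : 'M[R[i]]_n) :
  A \is hermsymmx ->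
  exp_series (K := R[i]) (('i * t%:C) *: A) @ \oo
    --> (expmx (('i * t%:C) *: A) : 'M[R[i] : numFieldType]_n).
Proof.
move=> /hermitian_diagonalization[P [r [Pu ->]]].
rewrite expmx_diagonalizable//; exact: cvg_exp_series_diagonalizable.
Qed.

Lemma expmx_intertwine (R : realType) m n (t : R) (A : 'M[R[i]]_m) (B : 'M[R[i]]_n)
    (W : 'M[R[i]]_(m, n)) :
  A \is hermsymmx -> B \is hermsymmx -> A *m W = W *m B ->
  expmx (('i * t%:C) *: A) *m W = W *m expmx (('i * t%:C) *: B).
Proof.
move=> hA hB AW.
apply: (@intertwine_exp_lim R[i] _ _ _ _ _ _ _ _ (@cvg_expmx_hermitian R m t A hA)
  (@cvg_expmx_hermitian R n t B hB)).
by rewrite -scalemxAl -scalemxAr AW.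
Qed.

(** * Phases and shifts by scalar matrices *)

Lemma cisD (R : realType) (s t : R) : cis (s + t) = cis s * cis t.
Proof. by rewrite /cis cosD sinD; simpc; rewrite [sin s * _ + _]addrC. Qed.

Lemma cis_2pi_natmul (R : realType) k : cis (pi *+ 2 *+ k) = 1 :> R[i].
Proof.
have := periodicn (@cosD2pi R) k 0; have := periodicn (@sinD2pi R) k 0.
by rewrite /cis add0r cos0 sin0 => -> ->.
Qed.

Lemma expmx_scalar (R : realType) n (t c : R) :
  expmx (('i * t%:C) *: (c%:C)%:M) = (cis (t * c))%:M :> 'M[R[i]]_n.
Proof.
have := @expmx_diagonalizable R n t 1%:M (fun=> c) (unitmx1 _ _).
rewrite invmx1 !mul1mx !mulmx1.
have E (x : R[i]) : diag_mx (\row_(j < n) x) = x%:M.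
  by rewrite -diag_const_mx; congr diag_mx; apply/rowP => j; rewrite !mxE.
by rewrite !E.
Qed.

(** The same [P] diagonalizes the shifted matrix, with eigenvalues [r j + c]; [cisD] extracts the
    common phase. *)
Lemma expmx_shift (R : realType) n (t c : R) (A : 'M[R[i]]_n) :
  A \is hermsymmx ->
  expmx (('i * t%:C) *: (A + (c%:C)%:M)) = cis (t * c) *: expmx (('i * t%:C) *: A).
Proof.
move=> /hermitian_diagonalization[P [r [Pu ->]]].
have -> : invmx P *m diag_mx (\row_j (r j)%:C) *m P + (c%:C)%:M =
    invmx P *m diag_mx (\row_j (r j + c)%:C) *m P.
  have -> : \row_j (r j + c)%:C = \row_j (r j)%:C + const_mx c%:C :> 'rV[R[i]]_n.
    by apply/rowP => j; rewrite !mxE rmorphD.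
  rewrite linearD /= diag_const_mx mulmxDr mulmxDl mul_mx_scalar -scalemxAl.
  by rewrite mulVmx// scalemx1.
rewrite [LHS](expmx_diagonalizable t (fun j => r j + c) Pu).
rewrite [expmx _](expmx_diagonalizable t r Pu).
have -> : \row_j cis (t * (r j + c)) = cis (t * c) *: \row_j cis (t * r j) :> 'rV[R[i]]_n.
  by apply/rowP => j; rewrite !mxE mulrDr cisD mulrC.
by rewrite linearZ /= -scalemxAr -scalemxAl.
Qed.

Lemma hermitianD (C : numClosedFieldType) n (A B : 'M[C]_n) :
  A \is hermsymmx -> B \is hermsymmx -> A + B \is hermsymmx.
Proof.
move=> /is_hermitianmxP hA /is_hermitianmxP hB; apply/is_hermitianmxP.
by rewrite linearD /= map_mxD scalerDr -hA -hB.
Qed.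

Lemma scalar_hermitian (R : realType) n (c : R) :
  ((c%:C)%:M : 'M[R[i]]_n) \is hermsymmx.
Proof.
apply: realsym_hermsym.
  by apply/is_hermitianmxP; rewrite expr0 scale1r map_mx_id// tr_scalar_mx.
apply/mxOverP => u v; rewrite !mxE; apply: rpredMn.
by apply/complex_realP; exists c.
Qed.

(** * The Laplacian of a join *)

Lemma laplacian_hermitian (R : realType) n (X : sgraph n) :
  laplacian R[i] X \is hermsymmx.
Proof.
apply: realsym_hermsym.
  apply/is_hermitianmxP; rewrite expr0 scale1r map_mx_id//.
  apply/matrixP => u v; rewrite !mxE adj_sym eq_sym.
  by have [->|] := eqVneq u v.
apply/mxOverP => u v; rewrite !mxE.
by apply: rpredB; [apply: rpredMn|]; exact: realn.
Qed.

Lemma degreeE n (X : sgraph n) u : degree X u = (\sum_v X u v)%N.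
Proof.
rewrite /degree -sum1_card big_mkcond /=; apply: eq_bigr => v _.
by rewrite inE; case: (X u v).
Qed.

Lemma laplacian_rowsum (K : nzRingType) n (X : sgraph n) u :
  \sum_v laplacian K X u v = 0.
Proof.
under eq_bigr do rewrite !mxE.
rewrite big_split /= sumrN -natr_sum -degreeE.
under eq_bigr do rewrite mulrb.
by rewrite -big_mkcond /= (big_pred1 u) ?subrr //; move=> v; exact: eq_sym.
Qed.

Lemma laplacian_mul_const (K : nzRingType) n p (X : sgraph n) (c : K) :
  laplacian K X *m const_mx c = 0 :> 'M[K]_(n, p).
Proof.
apply/matrixP => u v; rewrite !mxE.
under eq_bigr do rewrite [const_mx _ _ _]mxE.
by rewrite -mulr_suml laplacian_rowsum mul0r.
Qed.

Lemma laplacian_sym (K : nzRingType) n (X : sgraph n) u v :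
  laplacian K X u v = laplacian K X v u.
Proof. by rewrite !mxE adj_sym eq_sym; have [->|] := eqVneq u v. Qed.

Lemma const_mul_laplacian (K : nzRingType) n p (X : sgraph n) (c : K) :
  const_mx c *m laplacian K X = 0 :> 'M[K]_(p, n).
Proof.
apply/matrixP => u v; rewrite !mxE.
under eq_bigr do rewrite [const_mx _ _ _]mxE laplacian_sym.
by rewrite -mulr_sumr laplacian_rowsum mulr0.
Qed.

Lemma degree_join_l m n (X : sgraph m) (Y : sgraph n) x :
  degree (graph_join X Y) (lshift n x) = (degree X x + n)%N.
Proof.
rewrite !degreeE big_split_ord /=; congr (_ + _)%N.
  by apply: eq_bigr => y _; rewrite /join_adj !(unsplitK (inl _)).
under eq_bigr do rewrite /join_adj (unsplitK (inl _)) (unsplitK (inr _)).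
by rewrite sum_nat_const card_ord muln1.
Qed.

Lemma degree_join_r m n (X : sgraph m) (Y : sgraph n) y :
  degree (graph_join X Y) (rshift m y) = (degree Y y + m)%N.
Proof.
rewrite !degreeE big_split_ord /= addnC; congr (_ + _)%N.
  by apply: eq_bigr => z _; rewrite /join_adj !(unsplitK (inr _)).
under eq_bigr do rewrite /join_adj (unsplitK (inl _)) (unsplitK (inr _)).
by rewrite sum_nat_const card_ord muln1.
Qed.

(** Each degree grows by the order of the other graph, and all cross pairs are adjacent. *)
Lemma laplacian_join (K : nzRingType) m n (X : sgraph m) (Y : sgraph n) :
  laplacian K (graph_join X Y) =
  block_mx (laplacian K X + n%:R%:M) (const_mx (-1))
           (const_mx (-1)) (laplacian K Y + m%:R%:M).
Proof.
apply/matrixP => u v; case: (split_ordP u) => i ->; case: (split_ordP v) => j ->.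
- rewrite block_mxEul !mxE /= /join_adj !(unsplitK (inl _)) eq_lshift degree_join_l.
  by rewrite natrD mulrnDl addrAC.
- rewrite block_mxEur !mxE /= /join_adj (unsplitK (inl _)) (unsplitK (inr _)).
  by rewrite eq_lrshift mulr0n add0r.
- rewrite block_mxEdl !mxE /= /join_adj (unsplitK (inl _)) (unsplitK (inr _)).
  by rewrite eq_rlshift mulr0n add0r.
- rewrite block_mxEdr !mxE /= /join_adj !(unsplitK (inr _)) eq_rshift degree_join_r.
  by rewrite natrD mulrnDl addrAC.
Qed.

(** * The transition matrix of a join *)

(** An eigenvalue equation is an intertwining with a scalar matrix, whose exponential is a phase. *)
Lemma transition_eigen (R : realType) n (X : sgraph n) (t l : R) p (W : 'M[R[i]]_(n, p)) :
  laplacian R[i] X *m W = l%:C *: W -> transition X t *m W = cis (t * l) *: W.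
Proof.
move=> LW; rewrite /transition.
rewrite (@expmx_intertwine _ _ _ _ _ (l%:C)%:M).
- by rewrite expmx_scalar mul_mx_scalar.
- exact: laplacian_hermitian.
- exact: scalar_hermitian.
- by rewrite mul_mx_scalar.
Qed.

(** Constant rows are left eigenvectors for the eigenvalue 0, that is, they intertwine the zero
    matrix with the Laplacian. *)
Lemma const_mul_transition (R : realType) n (X : sgraph n) (t : R) p (c : R[i]) :
  const_mx c *m transition X t = const_mx c :> 'M[R[i]]_(p, n).
Proof.
rewrite /transition -(@expmx_intertwine _ _ _ _ ((0 : R)%:C)%:M).
- by rewrite expmx_scalar mulr0 /cis cos0 sin0 mul1mx.
- exact: scalar_hermitian.
- exact: laplacian_hermitian.
- by rewrite const_mul_laplacian mul_scalar_mx scale0r.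
Qed.

Lemma join_mul_const_l (K : comNzRingType) m n (X : sgraph m) (Y : sgraph n) (c : K) :
  laplacian K (graph_join X Y) *m col_mx (const_mx c) 0 =
  col_mx (const_mx (n%:R * c)) (const_mx (- (m%:R * c))) :> 'cV[K]_(m + n).
Proof.
rewrite laplacian_join mul_block_col !mulmx0 !addr0 mulmxDl laplacian_mul_const.
rewrite add0r mul_scalar_mx; congr col_mx; apply/matrixP => i j; rewrite !mxE//.
under eq_bigr do rewrite !mxE mulN1r.
by rewrite sumrN sumr_const card_ord mulr_natl.
Qed.

Lemma transition_join_ones (R : realType) m n (X : sgraph m) (Y : sgraph n) (t : R) :
  (0 < m)%N -> cis (t * (m + n)%:R) = 1 :> R[i] ->
  transition (graph_join X Y) t *m col_mx (const_mx 1) 0 =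
    col_mx (const_mx 1) 0 :> 'cV_(m + n).
Proof.
move=> m0 cis1.
set L := laplacian R[i] (graph_join X Y); set u := col_mx _ _.
have s0 : (m + n)%:R != 0 :> R[i] by rewrite pnatr_eq0 -lt0n addn_gt0 m0.
(* (m + n) u is the sum of an eigenvector m 1 for the eigenvalue 0 and of the
   eigenvector L u for the eigenvalue m + n. *)
have Lu : L *m u = (m + n)%:R *: u - const_mx m%:R.
  rewrite /L /u join_mul_const_l mulr1 mulr1 -[const_mx m%:R]vsubmxK.
  rewrite scale_col_mx opp_col_mx add_col_mx scaler0 add0r.
  congr col_mx; apply/matrixP => i j; rewrite !mxE//.
  by rewrite mulr1 natrD addrAC subrr add0r.
have LLu : L *m (L *m u) = (m + n)%:R *: (L *m u).
  by rewrite {1}Lu mulmxBr -scalemxAr laplacian_mul_const subr0.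
have e1 : transition (graph_join X Y) t *m (L *m u) = L *m u.
  have := @transition_eigen R _ (graph_join X Y) t (m + n)%:R _ (L *m u).
  by rewrite cis1 scale1r rmorph_nat; apply.
have e0 : transition (graph_join X Y) t *m const_mx m%:R = const_mx m%:R :> 'cV_(m + n).
  have := @transition_eigen R _ (graph_join X Y) t 0 _ (const_mx m%:R : 'cV_(m + n)).
  by rewrite laplacian_mul_const scale0r mulr0 /cis cos0 sin0 scale1r; exact.
(* [Lu] is solved for [u], writing it through two vectors that the transition matrix fixes. *)
have uE : u = (m + n)%:R^-1 *: (L *m u + const_mx m%:R).
  by rewrite Lu subrK scalerA mulVf// scale1r.
by rewrite uE -scalemxAr mulmxDr e1 e0.
Qed.

Lemma transition_join_lift (R : realType) m n (X : sgraph m) (Y : sgraph n) (t : R) p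
    (v : 'M[R[i]]_(m, p)) :
  (0 < m)%N -> cis (t * m%:R) = 1 :> R[i] -> cis (t * n%:R) = 1 :> R[i] ->
  transition (graph_join X Y) t *m col_mx v 0 = col_mx (transition X t *m v) 0.
Proof.
move=> m0 cism cisn.
have cismn : cis (t * (m + n)%:R) = 1 :> R[i].
  by rewrite natrD mulrDr cisD cism cisn mulr1.
have mn0 : m%:R != 0 :> R[i] by rewrite pnatr_eq0 -lt0n.
(* [J] is the orthogonal projection onto the constants. *)
pose J := const_mx m%:R^-1 : 'M[R[i]]_m.
pose W := col_mx (1%:M - J) 0 : 'M[R[i]]_(m + n, m).
have LW : laplacian R[i] (graph_join X Y) *m W = W *m (laplacian R[i] X + (n%:R%:C)%:M).
  rewrite laplacian_join mul_block_col !mulmx0 !addr0 mul_col_mx mul0mx.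
  rewrite (rmorph_nat (real_complex R)).
  congr col_mx.
    rewrite [LHS]mulmxDl [RHS]mulmxDr mul_scalar_mx mul_mx_scalar; congr (_ + _).
    rewrite [LHS]mulmxBr [RHS]mulmxBl mulmx1 mul1mx.
    by rewrite laplacian_mul_const const_mul_laplacian.
  (* The lower block vanishes because the columns of [1%:M - J] sum to 0. *)
  rewrite mulmxBr mulmx1; apply/matrixP => i j; rewrite !mxE.
  under eq_bigr do rewrite !mxE mulN1r.
  by rewrite sumrN sumr_const card_ord -[_^-1 *+ _]mulr_natl mulfV// subrr.
have UW : transition (graph_join X Y) t *m W = W *m transition X t.
  have := expmx_intertwine t (laplacian_hermitian R (graph_join X Y))
    (hermitianD (laplacian_hermitian R X) (scalar_hermitian m (n%:R : R))) LW.
  by rewrite (expmx_shift t n%:R (laplacian_hermitian R X)) cisn scale1r.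
(* [J] has rank one, so its image under the transition matrix reduces to that of the indicator of
   [X]. *)
have JE : col_mx J 0 =
    m%:R^-1 *: (col_mx (const_mx 1) 0 *m (const_mx 1 : 'rV_m)) :> 'M[R[i]]_(m + n, m).
  rewrite mul_col_mx mul0mx scale_col_mx scaler0; congr col_mx.
  by apply/matrixP => i j; rewrite !mxE big_ord1 !mxE !mulr1.
have UJ : transition (graph_join X Y) t *m col_mx J 0 = col_mx J 0.
  by rewrite JE -scalemxAr mulmxA transition_join_ones.
have WJ (w : 'M[R[i]]_(m, p)) :
    col_mx w 0 = W *m w + col_mx J 0 *m w :> 'M[R[i]]_(m + n, p).
  by rewrite -mulmxDl add_col_mx subrK addr0 mul_col_mx mul1mx mul0mx.
(* Both sides split along [1%:M - J] and [J]; the [J] parts agree since [J] absorbs the transition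
   matrix of [X]. *)
rewrite !WJ mulmxDr !mulmxA UW UJ; congr (_ + _).
by rewrite !mul_col_mx !mul0mx const_mul_transition.
Qed.

(** For [k = q * g] the angle is [q] full turns. *)
Lemma cis_2pi_div (R : realType) g k :
  (0 < g)%N -> (g %| k)%N -> cis (2 * pi / g%:R * k%:R) = 1 :> R[i].
Proof.
move=> g0 /dvdnP[q ->]; rewrite natrM.
have g0' : g%:R != 0 :> R by rewrite pnatr_eq0 -lt0n.
have -> : 2 * pi / g%:R * (q%:R * g%:R) = pi *+ 2 *+ q :> R.
  by rewrite mulrCA mulrA -mulrA; field.
exact: cis_2pi_natmul.
Qed.

Theorem theorem11p6 (R : realType) (m : nat) (X : sgraph m) (hm : (3 <= m)%N)
    (g : nat) (g_gt0 : (0 < g)%N) (g_dvd_m : (g %| m)%N) (a b : 'I_m)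
    (hX : proper_laplacian_FR X a b (2 * pi / g%:R : R))
    (n : nat) (Y : sgraph n) (g_dvd_n : (g %| n)%N) :
  proper_laplacian_FR (graph_join X Y) (lshift n a) (lshift n b)
    (2 * pi / g%:R : R).
Proof.
have vE (c : 'I_m) : vertex_vec R (lshift n c) = col_mx (vertex_vec R c) 0.
  rewrite /vertex_vec; apply/colP => i; case: (split_ordP i) => j ->.
    by rewrite col_mxEu !mxE eq_lshift.
  by rewrite col_mxEd !mxE eq_rlshift.
case: hX => ab [al [be [Ua be0]]]; split; first by rewrite eq_lshift.
exists al, be; split => //.
(* Since [g] divides both [m] and [n], both phases required by the lift equal 1. *)
rewrite !vE transition_join_lift ?cis_2pi_div//; last exact: leq_trans hm.
by rewrite Ua !scale_col_mx !scaler0 add_col_mx addr0.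
Qed.
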